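(* Let $(\Delta,g)$ be a rank-two sub-Riemannian structure on a smooth manifold $M$ with a global orthonormal frame $X_1,X_2$. Let $\gamma:[0,T]\to M$ be a regular abnormal geodesic that has a regular abnormal branching at time $\tau\in(0,T)$. If $\gamma|_{[0,\tau]}$ is strictly abnormal, then $\gamma$ and all the regular abnormal geodesics branching from $\gamma$ at time $\tau$ are strictly abnormal geodesics.
   Context: Setting: $M$ is a smooth manifold, $\Delta\subset TM$ a smooth totally nonholonomic (bracket-generating) distribution of constant rank $2$, $g$ a Riemannian metric on $\Delta$, and $X_1,X_2$ a fixed global $g$-orthonormal frame of smooth vector fields for $\Delta$. A horizontal curve is an absolutely continuous $\gamma:[0,T]\to M$ with $\dot\gamma=u_1X_1(\gamma)+u_2X_2(\gamma)$ a.e. for some (unique) control $u\in L^2([0,T],\mathbb{R}^2)$; its length is $L(\gamma)=\int_0^T|u(t)|\,dt$, and $d(p,q)$ is the infimum of lengths of horizontal curves from $p$ to $q$. A horizontal curve is a length minimizer if its length equals the distance $d$ between its endpoints; a geodesic is a horizontal curve with constant speed such that every $t\in[0,T]$ has an $\varepsilon>0$ for which the restriction to $[t-\varepsilon,t+\varepsilon]\cap[0,T]$ is a length minimizer. Notation: $\pi:T^*M\to M$ is the projection, $h_X(\lambda)=\langle\lambda,X(\pi(\lambda))\rangle$, $X_{i_1\dots i_k}=[X_{i_1},\dots,[X_{i_{k-1}},X_{i_k}]\dots]$, $h_{i_1\dots i_k}=h_{X_{i_1\dots i_k}}$. For a smooth function $h$ on $T^*M$, $\vec h$ is its Hamiltonian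 vector field, $\omega(\cdot,\vec h)=dh$ with $\omega$ the canonical symplectic form (in canonical coordinates $\dot x=\partial_p h$, $\dot p=-\partial_x h$). A normal lift of a horizontal curve $\gamma$ is an integral curve $\lambda(\cdot)$ of $\vec H$, $H=\frac12(h_1^2+h_2^2)$, with $\pi\circ\lambda=\gamma$. An abnormal lift of a horizontal curve $\gamma$ with control $u$ is an absolutely continuous $\lambda(\cdot)$ in $T^*M$ with $\pi\circ\lambda=\gamma$, $\lambda(t)\neq0$, $h_1(\lambda(t))=h_2(\lambda(t))=0$ for all $t$, and $\dot\lambda=u_1\vec h_1(\lambda)+u_2\vec h_2(\lambda)$ a.e. A curve is strictly abnormal if it has an abnormal lift and no normal lift. Let $\Delta_2^\perp=\{h_1=h_2=h_{12}=0\}$, $\Delta_3^\perp=\{h_1=h_2=h_{12}=h_{112}=h_{212}=0\}\subset T^*M$ and $\mathcal{R}=\Delta_2^\perp\setminus\Delta_3^\perp$, a submanifold of $T^*M$. On $\mathcal{R}$ the vector field (tangent to $\mathcal R$) $$\vec G=\frac{-h_{212}}{\sqrt{h_{212}^2+h_{112}^2}}\,\vec h_1+\frac{h_{112}}{\sqrt{h_{212}^2+h_{112}^2}}\,\vec h_2$$ is defined. A regular abnormal path is the projection to $M$ of an integral curve (contained in $\mathcal{R}$) of $\vec G$ or $-\vec G$. It is known that every regular abnormal path is a (unit-speed) geodesic; it is then called a regular abnormal geodesic. A regular abnormal geodesic $\bar\gamma:[0,\tau+\varepsilon_0]\to M$, $\varepsilon_0>0$, branches from $\gamma$ at time $\tau\in(0,T)$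 if $\bar\gamma|_{[0,\tau]}=\gamma|_{[0,\tau]}$ and $\bar\gamma|_{[0,\tau+\varepsilon]}\neq\gamma|_{[0,\tau+\varepsilon]}$ for all $0<\varepsilon\le\varepsilon_0$; $\gamma$ has a regular abnormal branching at $\tau$ if such $\varepsilon_0$ and $\bar\gamma$ exist. *)

(* Defs.v *)
From HB Require Import structures.
From mathcomp Require Import all_boot all_order all_algebra.
From mathcomp Require Import all_classical all_reals all_analysis.

Set Implicit Arguments.
Unset Strict Implicit.
Unset Printing Implicit Defensive.

Import Order.TTheory GRing.Theory Num.Theory.
Import numFieldNormedType.Exports.

Local Open Scope classical_set_scope.
Local Open Scope ring_scope.

Fixpoint Ck (R : realType) (V W : normedModType R) (k : nat)
    (U : set V) (f : V -> W) : Prop :=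
  if k is k'.+1
  then (forall x, U x -> differentiable f x) /\ (forall v, Ck k' U ('D_v f))
  else forall x, U x -> {for x, continuous f}.

(* Meant for open U. *)
Definition smooth_on (R : realType) (V W : normedModType R)
    (U : set V) (f : V -> W) : Prop := forall k, Ck k U f.

(* Derivative at t of a curve defined on A; one-sided at the end points when A
   is an interval. *)
Definition deriv_within (R : realType) (V : normedModType R)
    (A : set R) (f : R -> V) (t : R) (v : V) : Prop :=
  (fun s => (s - t)^-1 *: (f s - f t)) @ within A (dnbhs t) --> v.

Definition abs_continuous (R : realType) (V : normedModType R)
    (a b : R) (f : R -> V) : Prop :=
  forall e : R, 0 < e -> exists2 d : R, 0 < d &
    forall (m : nat) (l r : 'I_m -> R),
      (forall i, [/\ a <= l i, l i <= r i & r i <= b]) ->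
      (forall i j, i != j -> r i <= l j \/ r j <= l i) ->
      \sum_(i < m) (r i - l i) < d ->
      \sum_(i < m) `|f (r i) - f (l i)| < e.

(* A smooth n-manifold given by a smooth atlas. As in the usual encoding of
   manifolds in type theory, every point q has a preferred chart [chart_at q]
   of the atlas. A tangent vector at q is represented by the row of its
   components in the preferred chart of q, and a covector at q by the column
   of its components there; the components in the other charts are
   computed by [vec_coord] and [cov_coord] below. *)
Record manifold (R : realType) (n : nat) := Manifold {
  mcarrier :> topologicalType ;
  m_hausdorff : hausdorff_space mcarrier ;
  m_second_countable : @second_countable mcarrier ;
  chart_index : Type ;
  chart_dom : chart_index -> set mcarrier ;
  chart : chart_index -> mcarrier -> 'rV[R]_n ;
  chart_inv : chart_index -> 'rV[R]_n -> mcarrier ;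
  chart_at : mcarrier -> chart_index ;
  chart_atP : forall q, chart_dom (chart_at q) q ;
  chart_dom_open : forall i, open (chart_dom i) ;
  chart_img_open : forall i, open (chart i @` chart_dom i) ;
  chartK : forall i q, chart_dom i q -> chart_inv i (chart i q) = q ;
  chart_continuous : forall i q, chart_dom i q -> {for q, continuous (chart i)} ;
  chart_inv_continuous : forall i x, (chart i @` chart_dom i) x ->
    {for x, continuous (chart_inv i)} ;
  transition_smooth : forall i j,
    smooth_on (chart i @` (chart_dom i `&` chart_dom j)) (chart j \o chart_inv i)
}.

Section Manifold.
Variables (R : realType) (n : nat) (M : manifold R n).

Definition chart_img (i : chart_index M) : set 'rV[R]_n := chart i @` chart_dom i.

Definition transition (i j : chart_index M) : 'rV[R]_n -> 'rV[R]_n :=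
  chart j \o chart_inv i.

(* ['J f x] acts on row vectors on the right: v *m 'J f x = 'd f x v. *)
Definition vec_coord (i : chart_index M) (q : M) (v : 'rV[R]_n) : 'rV[R]_n :=
  v *m 'J (transition (chart_at q) i) (chart (chart_at q) q).

Definition smooth_fun (f : M -> R) : Prop :=
  forall i, smooth_on (chart_img i) (f \o chart_inv i : 'rV[R]_n -> R^o).

Definition vfield : Type := M -> 'rV[R]_n.

Definition vfield_chart (i : chart_index M) (X : vfield) (x : 'rV[R]_n) :
    'rV[R]_n :=
  vec_coord i (chart_inv i x) (X (chart_inv i x)).

Definition smooth_vfield (X : vfield) : Prop :=
  forall i, smooth_on (chart_img i) (vfield_chart i X).

(* [X, Y] = DY.X - DX.Y in coordinates, that is XY - YX as derivations. *)
Definition bracket (X Y : vfield) : vfield := fun q =>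
  let i := chart_at q in
  'D_(X q) (vfield_chart i Y) (chart i q)
  - 'D_(Y q) (vfield_chart i X) (chart i q).

Record cotangent := Cotangent { basept : M ; covec : 'cV[R]_n }.

Definition cov_coord (i : chart_index M) (l : cotangent) : 'cV[R]_n :=
  'J (transition i (chart_at (basept l))) (chart i (basept l)) *m covec l.

(* Canonical coordinates (x, p) on T*M induced by the chart i, and the inverse
   parametrization. *)
Definition can_coord (i : chart_index M) (l : cotangent) :
    'rV[R]_n * 'cV[R]_n :=
  (chart i (basept l), cov_coord i l).

Definition can_inv (i : chart_index M) (x : 'rV[R]_n) (p : 'cV[R]_n) :
    cotangent :=
  let q := chart_inv i x in
  Cotangent q ('J (transition (chart_at q) i) (chart (chart_at q) q) *m p).

(* A vector field on T*M, given by its components in all the canonical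
   coordinate systems. *)
Definition cfield : Type :=
  cotangent -> chart_index M -> 'rV[R]_n * 'cV[R]_n.

Definition ham_field (h : cotangent -> R) : cfield := fun l i =>
  let x := chart i (basept l) in
  let p := cov_coord i l in
  (\row_k ('D_(delta_mx k 0) (fun p' => h (can_inv i x p') : R^o) p),
   \col_k (- 'D_(delta_mx 0 k) (fun x' => h (can_inv i x' p) : R^o) x)).

Definition ham_lift (X : vfield) (l : cotangent) : R :=
  (X (basept l) *m covec l) 0 0.

Definition velocity (A : set R) (gamma : R -> M) (t : R) (v : 'rV[R]_n) :
    Prop :=
  forall i, chart_dom i (gamma t) ->
    deriv_within A (chart i \o gamma) t (vec_coord i (gamma t) v).

Definition cvelocity (A : set R) (lam : R -> cotangent) (t : R)
    (V : chart_index M -> 'rV[R]_n * 'cV[R]_n) : Prop :=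
  forall i, chart_dom i (basept (lam t)) ->
    deriv_within A (can_coord i \o lam) t (V i).

Definition ac_curve (a b : R) (gamma : R -> M) : Prop :=
  {within `[a, b], continuous gamma} /\
  forall i c d, a <= c -> d <= b ->
    (forall t, t \in `[c, d] -> chart_dom i (gamma t)) ->
    abs_continuous c d (chart i \o gamma).

Definition ac_ccurve (a b : R) (lam : R -> cotangent) : Prop :=
  {within `[a, b], continuous (basept \o lam)} /\
  forall i c d, a <= c -> d <= b ->
    (forall t, t \in `[c, d] -> chart_dom i (basept (lam t))) ->
    abs_continuous c d (can_coord i \o lam).

Definition integral_curve (a b : R) (V : cfield) (lam : R -> cotangent) :
    Prop :=
  {within `[a, b], continuous (basept \o lam)} /\
  forall t, t \in `[a, b] -> cvelocity [set` `[a, b]] lam t (V (lam t)).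

Definition is_section (D : M -> {vspace 'rV[R]_n}) (X : vfield) : Prop :=
  smooth_vfield X /\ forall q, X q \in D q.

(* The Lie algebra of vector fields generated by the sections of D. *)
Inductive lie_hull (D : M -> {vspace 'rV[R]_n}) : vfield -> Prop :=
| lie_section X : is_section D X -> lie_hull D X
| lie_add X Y : lie_hull D X -> lie_hull D Y -> lie_hull D (fun q => X q + Y q)
| lie_scale (c : R) X : lie_hull D X -> lie_hull D (fun q => c *: X q)
| lie_bracket X Y : lie_hull D X -> lie_hull D Y -> lie_hull D (bracket X Y).

Definition bracket_generating (D : M -> {vspace 'rV[R]_n}) : Prop :=
  forall (q : M) (v : 'rV[R]_n), exists2 X, lie_hull D X & X q = v.

Record sub_riemannian2 := SubRiemannian2 {
  Delta : M -> {vspace 'rV[R]_n} ;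
  Delta_rank : forall q, \dim (Delta q) = 2 ;
  Delta_smooth : forall q v, v \in Delta q -> exists2 X, is_section Delta X & X q = v ;
  Delta_nonholonomic : bracket_generating Delta ;
  metric : M -> 'rV[R]_n -> 'rV[R]_n -> R ;
  metric_sym : forall q, {in Delta q &, forall v w, metric q v w = metric q w v} ;
  metric_lin : forall q (c : R), {in Delta q & &, forall v v' w,
    metric q (c *: v + v') w = c * metric q v w + metric q v' w} ;
  metric_pos : forall q, {in Delta q, forall v, v != 0 -> 0 < metric q v v} ;
  metric_smooth : forall X Y, is_section Delta X -> is_section Delta Y ->
    smooth_fun (fun q => metric q (X q) (Y q))
}.

Definition orthonormal_frame (S : sub_riemannian2) (X1 X2 : vfield) : Prop :=
  [/\ is_section (Delta S) X1, is_section (Delta S) X2 &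
      forall q, [/\ metric S q (X1 q) (X1 q) = 1,
                    metric S q (X2 q) (X2 q) = 1 &
                    metric S q (X1 q) (X2 q) = 0]].

(* Curves are total functions on R, looked at on an interval only: the
   restriction of a curve is the same function on a smaller interval. *)
Section Frame.
Variables X1 X2 : vfield.

Definition is_control (a b : R) (gamma : R -> M) (u1 u2 : R -> R) : Prop :=
  [/\ ac_curve a b gamma,
      measurable_fun [set` `[a, b]] u1, measurable_fun [set` `[a, b]] u2,
      (\int[lebesgue_measure]_(t in `[a, b]) (u1 t ^+ 2 + u2 t ^+ 2)%:E
        < +oo)%E &
      {ae lebesgue_measure, forall t : R, t \in `[a, b] ->
        velocity [set` `[a, b]] gamma t
          (u1 t *: X1 (gamma t) + u2 t *: X2 (gamma t))}].

Definition speed (u1 u2 : R -> R) (t : R) : R :=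
  Num.sqrt (u1 t ^+ 2 + u2 t ^+ 2).

Definition control_length (a b : R) (u1 u2 : R -> R) : \bar R :=
  (\int[lebesgue_measure]_(t in `[a, b]) (speed u1 u2 t)%:E)%E.

Definition sr_distance (p q : M) : \bar R :=
  ereal_inf [set L | exists (T : R) (gamma : R -> M) (u1 u2 : R -> R),
    [/\ 0 < T, gamma 0 = p, gamma T = q,
        is_control 0 T gamma u1 u2 & L = control_length 0 T u1 u2]].

Definition length_minimizer (a b : R) (gamma : R -> M) : Prop :=
  exists u1 u2, is_control a b gamma u1 u2 /\
    control_length a b u1 u2 = sr_distance (gamma a) (gamma b).

Definition geodesic (T : R) (gamma : R -> M) : Prop :=
  (exists u1 u2, is_control 0 T gamma u1 u2 /\
    exists c : R, {ae lebesgue_measure, forall t : R, t \in `[0, T] ->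
      speed u1 u2 t = c}) /\
  forall t, t \in `[0, T] -> exists2 e : R, 0 < e &
    length_minimizer (Num.max 0 (t - e)) (Num.min T (t + e)) gamma.

Definition h1 := ham_lift X1.
Definition h2 := ham_lift X2.
Definition h12 := ham_lift (bracket X1 X2).
Definition h112 := ham_lift (bracket X1 (bracket X1 X2)).
Definition h212 := ham_lift (bracket X2 (bracket X1 X2)).

Definition is_lift (T : R) (gamma : R -> M) (lam : R -> cotangent) : Prop :=
  forall t, t \in `[0, T] -> basept (lam t) = gamma t.

Definition ham_H (l : cotangent) : R := 2^-1 * (h1 l ^+ 2 + h2 l ^+ 2).

Definition normal_lift (T : R) (gamma : R -> M) (lam : R -> cotangent) : Prop :=
  is_lift T gamma lam /\ integral_curve 0 T (ham_field ham_H) lam.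

Definition abnormal_lift (T : R) (gamma : R -> M) (lam : R -> cotangent) :
    Prop :=
  exists u1 u2,
  [/\ is_control 0 T gamma u1 u2,
      ac_ccurve 0 T lam,
      is_lift T gamma lam,
      forall t, t \in `[0, T] ->
        [/\ covec (lam t) != 0, h1 (lam t) = 0 & h2 (lam t) = 0] &
      {ae lebesgue_measure, forall t : R, t \in `[0, T] ->
        cvelocity [set` `[0, T]] lam t (fun i =>
          u1 t *: ham_field h1 (lam t) i + u2 t *: ham_field h2 (lam t) i)}].

Definition strictly_abnormal (T : R) (gamma : R -> M) : Prop :=
  (exists lam, abnormal_lift T gamma lam) /\
  ~ (exists lam, normal_lift T gamma lam).

Definition Delta2_perp : set cotangent :=
  [set l | [/\ h1 l = 0, h2 l = 0 & h12 l = 0]].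

Definition Delta3_perp : set cotangent :=
  [set l | [/\ h1 l = 0, h2 l = 0, h12 l = 0, h112 l = 0 & h212 l = 0]].

Definition reg_set : set cotangent := Delta2_perp `\` Delta3_perp.

(* Meaningful on reg_set only, where the square root is positive. *)
Definition G_field : cfield := fun l i =>
  let r := Num.sqrt (h212 l ^+ 2 + h112 l ^+ 2) in
  (- h212 l / r) *: ham_field h1 l i + (h112 l / r) *: ham_field h2 l i.

Definition regular_abnormal_path (T : R) (gamma : R -> M) : Prop :=
  exists lam,
  [/\ forall t, t \in `[0, T] -> reg_set (lam t),
      integral_curve 0 T G_field lam \/
        integral_curve 0 T (fun l i => - G_field l i) lam &
      is_lift T gamma lam].

Definition regular_abnormal_geodesic (T : R) (gamma : R -> M) : Prop :=
  regular_abnormal_path T gamma /\ geodesic T gamma.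

(* gamma only lives on [0, T], whence the bound t <= T in the last clause. It
   is harmless: the clause for small e implies the clause for larger e. *)
Definition branches_from (T : R) (gamma : R -> M) (tau eps0 : R)
    (gbar : R -> M) : Prop :=
  [/\ 0 < eps0,
      regular_abnormal_geodesic (tau + eps0) gbar,
      forall t, t \in `[0, tau] -> gbar t = gamma t &
      forall e, 0 < e <= eps0 ->
        exists2 t, (0 <= t <= tau + e) && (t <= T) & gbar t <> gamma t].

Definition has_regular_abnormal_branching (T : R) (gamma : R -> M) (tau : R) :
    Prop :=
  exists eps0 gbar, branches_from T gamma tau eps0 gbar.

Definition strictly_abnormal_geodesic (T : R) (gamma : R -> M) : Prop :=
  geodesic T gamma /\ strictly_abnormal T gamma.

End Frame.
End Manifold.

(* Main.v *)
Require Import Defs.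
From HB Require Import structures.
From mathcomp Require Import all_boot all_order all_algebra.
From mathcomp Require Import all_classical all_reals all_analysis.

Set Implicit Arguments.
Unset Strict Implicit.
Unset Printing Implicit Defensive.

Import Order.TTheory GRing.Theory Num.Theory.
Import numFieldNormedType.Exports.

Local Open Scope classical_set_scope.
Local Open Scope ring_scope.

(** The absence of a normal lift is inherited by longer curves: a normal lift
    on [0, T] restricts to one on [0, tau] ([normal_lift_restrict]).  A curve
    that agrees with gamma on [0, tau] therefore has no normal lift, since
    gamma has none there.  This applies to gamma and to every branch.  What is
    left is that each of them has an abnormal lift on its whole interval
    ([abnormal_lift_of_regular_abnormal_geodesic]), and the natural candidate
    is the integral curve lam of G or -G, in the regular set, whose projection
    it is.  There h1, h2 and h12 vanish, while h112 or h212 does not, so lam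
    is nonzero.

    Two points of that claim need an argument.

    Control.  The field G prescribes weights of h1 and h2 along lam, whereas an
    abnormal lift must be driven by a measurable square-integrable control of
    its projection.  A geodesic comes with such a control.  At almost every
    time both the control and the weights of G express the velocity of the
    curve in the frame X1, X2, which is free ([frame_free]), so they agree.
    The measurability of the weights, which involve iterated brackets, thus
    never has to be examined.

    Absolute continuity of lam.  In the canonical coordinates (x, p) of a
    chart, the lift of a field X reads p.X(x), so its Hamiltonian field is
    (X(x), - p.DX(x)), which is continuous in (x, p) ([ham_field_lift]).  The
    weights of G have absolute value at most 1, so lam has a bounded
    derivative on every interval spent in the chart, and the mean value
    inequality makes it Lipschitz there ([bounded_control_ac_ccurve]). *)

(** * Derivatives relative to a set *)

Lemma deriv_withinP (R : realType) (V : normedModType R) (A : set R)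
    (f : R -> V) (t : R) (v : V) :
  deriv_within A f t v <-> forall U, nbhs v U ->
    \forall s \near t, s != t -> A s -> U ((s - t)^-1 *: (f s - f t)).
Proof. by []. Qed.

Lemma deriv_within_subset (R : realType) (V : normedModType R) (A B : set R)
    (f : R -> V) (t : R) (v : V) :
  B `<=` A -> deriv_within A f t v -> deriv_within B f t v.
Proof.
move=> BA /deriv_withinP fv; apply/deriv_withinP => U /fv.
by apply: filterS => s + st /BA As; apply.
Qed.

Lemma deriv_within_eq (R : realType) (V : normedModType R) (A : set R)
    (f g : R -> V) (t : R) (v : V) :
  (forall s, A s -> f s = g s) -> A t ->
  deriv_within A f t v -> deriv_within A g t v.
Proof.
move=> fg At /deriv_withinP fv; apply/deriv_withinP => U /fv.
by apply: filterS => s + st As; rewrite !fg//; apply.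
Qed.

Lemma deriv_within_continuous (R : realType) (V : normedModType R) (A : set R)
    (f : R -> V) (t : R) (v : V) :
  deriv_within A f t v -> f @ within A (nbhs t) --> f t.
Proof.
move=> fv.
have id0 : (fun s : R => s - t) @ within A (dnbhs t) --> (0 : R).
  apply: cvg_within_filter; apply: cvg_within_filter.
  have {2}-> : 0 = t - t by rewrite subrr.
  by apply: cvgB; [exact: cvg_id | exact: cvg_cst].
have FF : Filter (within A (dnbhs t)) by exact: within_filter.
have h : (fun s => (s - t) *: ((s - t)^-1 *: (f s - f t)))
    @ within A (dnbhs t) --> (0 : R) *: v by apply: cvgZ.
rewrite scale0r in h.
have {}h : (fun s => (s - t) *: ((s - t)^-1 *: (f s - f t)) + f t)
    @ within A (dnbhs t) --> f t.
  by rewrite -[X in _ --> X]add0r; apply: cvgD; [exact: h|exact: cvg_cst].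
move=> U Uf.
have {}h : \forall s \near t, s != t -> A s ->
    U ((s - t) *: ((s - t)^-1 *: (f s - f t)) + f t) by exact: h Uf.
change (\forall s \near t, A s -> U (f s)).
apply: filterS h => s hs As.
have [->|st] := eqVneq s t; first exact: nbhs_singleton.
have := hs st As.
rewrite scalerA divff ?scale1r ?subrK//.
by rewrite subr_eq0.
Qed.

Lemma deriv_within_comp (R : realType) (V W : normedModType R) (A : set R)
    (L : {linear V -> W}) (f : R -> V) (t : R) (v : V) :
  {for v, continuous L} -> deriv_within A f t v ->
  deriv_within A (L \o f) t (L v).
Proof.
move=> Lc fv.
have : (fun s => L ((s - t)^-1 *: (f s - f t))) @ within A (dnbhs t) --> L v.
  exact: (cvg_comp _ _ fv Lc).
apply: cvg_trans; apply: near_eq_cvg; apply: nearW => s /=.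
by rewrite linearZ linearB.
Qed.

(** Nondegeneracy of the interval makes every point of it, end points included,
    a limit point of the others; this gives uniqueness of relative
    derivatives. *)
Lemma within_itv_proper (R : realType) (a b t : R) : a < b -> t \in `[a, b] ->
  ProperFilter (within [set` `[a, b]] (dnbhs t)).
Proof.
move=> ab; rewrite in_itv /= => /andP[at_ tb].
apply: Build_ProperFilter; rewrite /within /= => h.
have {h} : \forall s \near t, s != t -> ~ (s \in `[a, b]).
  by move: h; apply: filterS.
move=> /nbhs_ballP[e /= e0 he].
have [tb'|bt] := ltP t b.
  have m0 : 0 < Num.min (e / 2) (b - t) by rewrite lt_min divr_gt0//= subr_gt0.
  apply: (he (t + Num.min (e / 2) (b - t))).
  - rewrite /ball /= opprD addNKr normrN gtr0_norm//.
    by rewrite gt_min ltr_pdivrMr// ltr_pMr// ltr1n.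
  - by rewrite gt_eqF// ltrDl.
  - rewrite in_itv /= (le_trans at_) ?lerDl ?(ltW m0)//=.
    by rewrite -lerBrDl ge_min lexx orbT.
have ta : a < t by exact: lt_le_trans bt.
have m0 : 0 < Num.min (e / 2) (t - a) by rewrite lt_min divr_gt0//= subr_gt0.
apply: (he (t - Num.min (e / 2) (t - a))).
- rewrite /ball /= opprB addrC subrK gtr0_norm//.
  by rewrite gt_min ltr_pdivrMr// ltr_pMr// ltr1n.
- by rewrite lt_eqF// gtrBl.
- rewrite in_itv /= (le_trans _ tb) ?gerBl ?(ltW m0)// andbT.
  by rewrite lerBrDl -lerBrDr ge_min lexx orbT.
Qed.

Lemma deriv_within_unique (R : realType) (V : normedModType R) (a b t : R)
    (f : R -> V) (v w : V) : a < b -> t \in `[a, b] ->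
  deriv_within [set` `[a, b]] f t v -> deriv_within [set` `[a, b]] f t w ->
  v = w.
Proof.
move=> ab tab fv fw; have ? := within_itv_proper ab tab.
exact: (cvg_unique _ fv fw).
Qed.

(** The mean value inequality: at interior points of a subinterval, the relative
    derivative is a derivative, and the relative continuity at the end points
    is all that the mean value theorem asks for. *)
Lemma deriv_within_lipschitz (R : realType) (c d K : R) (f f' : R -> R) :
  (forall t, t \in `[c, d] ->
    deriv_within [set` `[c, d]] (f : R -> R^o) t (f' t)) ->
  (forall t, t \in `[c, d] -> `|f' t| <= K) ->
  forall l r, c <= l -> l <= r -> r <= d -> `|f r - f l| <= K * (r - l).
Proof.
move=> df bf l r cl; rewrite le_eqVlt => /predU1P[->|lr] rd.
  by rewrite !subrr normr0 mulr0.
have sub x : x \in `[l, r] -> x \in `[c, d].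
  by rewrite !in_itv/= => /andP[lx xr]; rewrite (le_trans cl)// (le_trans xr).
have [x xlr ->] : exists2 x, x \in `]l, r[ & f r - f l = f' x * (r - l).
  apply: MVT => // [x xlr|].
    have {}xlr' : x \in `[l, r] by apply: subset_itv_oo_cc.
    have := deriv_within_subset sub (df _ (sub _ xlr')).
    move=> /deriv_withinP dfx.
    have {}dfx : (fun h => h^-1 *: ((f \o shift x) (h *: 1) - f x))
        @ (0 : R)^' --> f' x.
      move=> U /dfx /nbhs0P.
      move=> hU; change (\forall h \near (0 : R), h != 0 ->
        U (h^-1 *: ((f \o shift x) (h *: 1) - f x))).
      have hx : \forall e \near (0 : R), x + e \in `]l, r[.
        by apply: (nbhs0P (fun s => s \in `]l, r[) x).1; exact: near_in_itvoo.
      apply: filterS2 hx hU => h xhlr hU h0 /=.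
      have -> : (h *: 1 + x : R^o) = x + h.
        by rewrite addrC /GRing.scale /= mulr1.
      have := hU _ (subset_itv_oo_cc xhlr); rewrite addrAC subrr add0r.
      by apply; rewrite -subr_eq0 addrAC subrr add0r.
    apply: DeriveDef; first by apply/cvg_ex; exists (f' x).
    exact/cvg_lim.
  apply/subspace_continuousP => x /sub xcd.
  apply: (@deriv_within_continuous _ R^o _ _ _ (f' x)).
  exact: deriv_within_subset sub (df _ xcd).
rewrite normrM (gtr0_norm (x := r - l)) ?subr_gt0//.
apply: ler_wpM2r; first by rewrite subr_ge0 ltW.
by apply: bf; apply: sub; exact: subset_itv_oo_cc.
Qed.


(** * Pairing row vectors with column vectors *)

Lemma cvg_pairing (R : realType) (n : nat) (T : Type) (F : set_system T)
    (FF : Filter F) (A : T -> 'rV[R]_n) (B : T -> 'cV[R]_n)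
    (a : 'rV[R]_n) (b : 'cV[R]_n) :
  A @ F --> a -> B @ F --> b ->
  (fun s => (A s *m B s) 0 0 : R^o) @ F --> ((a *m b) 0 0 : R^o).
Proof.
move=> Aa Bb.
have -> : (fun s => (A s *m B s) 0 0 : R^o) =
    (fun s => \sum_j A s 0 j * B s j 0).
  by apply/funext => s; rewrite mxE.
rewrite mxE; elim: (index_enum _) => [|j r ih].
  by under eq_fun do rewrite big_nil; rewrite big_nil; exact: cvg_cst.
under eq_fun do rewrite big_cons; rewrite big_cons.
apply: cvgD => //; apply: cvgM.
  exact: (cvg_comp _ _ Aa (@coord_continuous _ _ _ 0 j a)).
exact: (cvg_comp _ _ Bb (@coord_continuous _ _ _ j 0 b)).
Qed.

Lemma derive_pairingl (R : realType) (V : normedModType R) (n : nat)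
    (F : V -> 'rV[R]_n) (p : 'cV[R]_n) (x v : V) : derivable F x v ->
  'D_v (fun y => (F y *m p) 0 0 : R^o) x = ('D_v F x *m p) 0 0.
Proof.
move=> dF; apply: cvg_lim => //.
have h : (fun h => ((h^-1 *: ((F \o shift x) (h *: v) - F x)) *m p) 0 0 : R^o)
    @ (0 : R)^' --> (('D_v F x *m p) 0 0 : R^o).
  by apply: cvg_pairing; [exact: dF|exact: cvg_cst].
move: h; apply: cvg_trans; apply: near_eq_cvg; apply: nearW => h /=.
by rewrite -scalemxAl mulmxBl !mxE.
Qed.

Lemma derive_pairingr (R : realType) (n : nat) (a : 'rV[R]_n) (p w : 'cV[R]_n) :
  'D_w (fun y => (a *m y) 0 0 : R^o) p = (a *m w) 0 0.
Proof.
apply: cvg_lim => //.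
have dI : derivable (id : 'cV[R]_n -> 'cV[R]_n) p w by exact: derivable_id.
have h : (fun h => (a *m (h^-1 *: ((id \o shift p) (h *: w) - id p))) 0 0 : R^o)
    @ (0 : R)^' --> ((a *m 'D_w id p) 0 0 : R^o).
  by apply: cvg_pairing; [exact: cvg_cst|exact: dI].
rewrite derive_id in h.
move: h; apply: cvg_trans; apply: near_eq_cvg; apply: nearW => h /=.
by rewrite -scalemxAr mulmxBr !mxE.
Qed.

(** * Bounded and Lipschitz curves in canonical coordinates *)

Lemma within_bounded (R : realType) (I : finType) (c d : R) (f : I -> R -> R) :
  (forall i t, t \in `[c, d] ->
    (f i : R -> R^o) @ within [set` `[c, d]] (nbhs t) --> (f i t : R^o)) ->
  exists K, forall i t, t \in `[c, d] -> `|f i t| <= K.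
Proof.
move=> fc.
have K i : exists K, 0 <= K /\ forall t, t \in `[c, d] -> `|f i t| <= K.
  have : compact ((f i : R -> R^o) @` [set` `[c, d]]).
    apply: continuous_compact; last exact: segment_compact.
    by apply/subspace_continuousP => t; exact: fc.
  move=> /compact_bounded[M [_ hM]]; exists (Num.max 0 (M + 1)).
  split=> [|t tcd]; first by rewrite le_max lexx.
  rewrite le_max; apply/orP; right.
  by apply: (hM (M + 1)); [rewrite ltrDl|exists t].
have [k hk] := choice K.
exists (\sum_i k i) => i t tcd.
rewrite (bigD1 i)//= (le_trans ((hk i).2 t tcd))// lerDl sumr_ge0// => j _.
exact: (hk j).1.
Qed.

(** Indexing the x- and the p-coordinates by one finite type lets the bounds
    and the mean value inequality be applied to all of them at once. *)
Definition canon_coord (R : realType) (n : nat) (k : 'I_n + 'I_n)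
    (w : 'rV[R]_n * 'cV[R]_n) : R^o :=
  match k with inl j => w.1 0 j | inr j => w.2 j 0 end.

Lemma canon_coord_is_linear (R : realType) (n : nat) (k : 'I_n + 'I_n) :
  linear (@canon_coord R n k).
Proof. by case: k => j a u v; rewrite /canon_coord /= !mxE. Qed.

HB.instance Definition _ (R : realType) (n : nat) (k : 'I_n + 'I_n) :=
  GRing.isLinear.Build R _ _ _ (@canon_coord R n k) (canon_coord_is_linear k).

Lemma continuous_canon_coord (R : realType) (n : nat) (k : 'I_n + 'I_n) :
  continuous (@canon_coord R n k).
Proof.
case: k => j w; rewrite /canon_coord /=.
  have h : (fst : 'rV[R]_n * 'cV[R]_n -> _) @ w --> w.1 by exact: cvg_fst.
  exact: (cvg_comp _ _ h (@coord_continuous _ _ _ 0 j w.1)).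
have h : (snd : 'rV[R]_n * 'cV[R]_n -> _) @ w --> w.2 by exact: cvg_snd.
exact: (cvg_comp _ _ h (@coord_continuous _ _ _ j 0 w.2)).
Qed.

Lemma norm_le_canon_coord (R : realType) (n : nat)
    (w : 'rV[R]_n * 'cV[R]_n) (K : R) :
  0 <= K -> (forall k, `|canon_coord k w| <= K) -> `|w| <= K.
Proof.
move=> K0 wK; rewrite prod_normE ge_max; apply/andP; split.
  rewrite /Num.Def.normr /= mx_normrE; apply: bigmax_le => // -[i j] _ /=.
  by rewrite ord1; exact: (wK (inl j)).
rewrite /Num.Def.normr /= mx_normrE; apply: bigmax_le => // -[i j] _ /=.
by rewrite ord1; exact: (wK (inr i)).
Qed.

Lemma lipschitz_abs_continuous (R : realType) (V : normedModType R)
    (c d K : R) (f : R -> V) :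
  (forall l r, c <= l -> l <= r -> r <= d -> `|f r - f l| <= K * (r - l)) ->
  abs_continuous c d f.
Proof.
move=> lip e e0; have K0 : 0 < `|K| + 1 by rewrite ltr_wpDl.
exists (e / (`|K| + 1)); first exact: divr_gt0.
move=> m l r cd _; rewrite ltr_pdivlMr// mulrC mulr_sumr; apply: le_lt_trans.
apply: ler_sum => i _; have [cl lr rd] := cd i.
apply: (le_trans (lip _ _ cl lr rd)).
apply: ler_wpM2r; first by rewrite subr_ge0.
by rewrite (le_trans (ler_norm _))// lerDl.
Qed.

(** * Hamiltonian fields in a chart *)

Section Chart.
Variables (R : realType) (n : nat) (M : manifold R n).

(** This holds for every x and p, even outside the image of the chart: the
    Jacobian that [can_inv] applies to the covector is the one that
    [vfield_chart] applies to the vector. *)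
Lemma ham_lift_can_inv (X : vfield M) (i : chart_index M) x p :
  ham_lift X (can_inv i x p) = (vfield_chart i X x *m p) 0 0.
Proof. by rewrite /ham_lift /vfield_chart /vec_coord /= mulmxA. Qed.

(** Hamilton's equations for h = p.X(x): the base moves along X, and the
    covector along - p.DX. *)
Lemma ham_field_lift (X : vfield M) (i : chart_index M) (l : cotangent M) :
  smooth_vfield X -> chart_dom i (basept l) ->
  ham_field (ham_lift X) l i =
    (vfield_chart i X (chart i (basept l)),
     \col_k (- ('D_(delta_mx 0 k) (vfield_chart i X) (chart i (basept l))
                *m cov_coord i l) 0 0)).
Proof.
move=> sX li; rewrite /ham_field; congr pair.
  apply/rowP => k; rewrite mxE.
  under eq_fun do rewrite ham_lift_can_inv.
  by rewrite derive_pairingr -colE mxE.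
apply/colP => k; rewrite !mxE; congr (- _).
under eq_fun do rewrite ham_lift_can_inv.
rewrite derive_pairingl ?mxE//; apply: diff_derivable.
by apply: (sX i 1%N).1; exists (basept l).
Qed.

Lemma fst_ham_field_lift (X : vfield M) (i : chart_index M) (l : cotangent M) :
  smooth_vfield X -> chart_dom i (basept l) ->
  (ham_field (ham_lift X) l i).1 = vec_coord i (basept l) (X (basept l)).
Proof.
move=> sX li; rewrite (ham_field_lift sX li).
change (vfield_chart i X (chart i (basept l)) =
  vec_coord i (basept l) (X (basept l))).
by rewrite /vfield_chart (chartK li).
Qed.

Lemma ham_field_bounded (X : vfield M) (i : chart_index M) (c d : R)
    (lam : R -> cotangent M) : smooth_vfield X ->
  (forall t, t \in `[c, d] -> chart_dom i (basept (lam t))) ->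
  (forall t, t \in `[c, d] ->
    (can_coord i \o lam) @ within [set` `[c, d]] (nbhs t)
      --> can_coord i (lam t)) ->
  exists K, forall k t, t \in `[c, d] ->
    `|canon_coord k (ham_field (ham_lift X) (lam t) i)| <= K.
Proof.
move=> sX dom lamc.
pose F := vfield_chart i X.
pose f (k : 'I_n + 'I_n) t : R := match k with
  | inl j => F (chart i (basept (lam t))) 0 j
  | inr j => - ('D_(delta_mx 0 j) F (chart i (basept (lam t)))
                *m cov_coord i (lam t)) 0 0 end.
have fE k t : t \in `[c, d] ->
    canon_coord k (ham_field (ham_lift X) (lam t) i) = f k t.
  move=> tcd; rewrite (ham_field_lift sX (dom t tcd)); case: k => j.
    by [].
  by rewrite /canon_coord /= [LHS]mxE.
have [K hK] : exists K, forall k t, t \in `[c, d] -> `|f k t| <= K.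
  apply: within_bounded => k t tcd.
  have ximg : chart_img i (chart i (basept (lam t))).
    by exists (basept (lam t)) => //; exact: dom.
  have xc : (fun s => chart i (basept (lam s))) @ within [set` `[c, d]] (nbhs t)
      --> chart i (basept (lam t)).
    have h : (fst : 'rV[R]_n * 'cV[R]_n -> _) @ can_coord i (lam t)
      --> chart i (basept (lam t)) by exact: cvg_fst.
    exact: (cvg_comp _ _ (lamc t tcd) h).
  have pc : (fun s => cov_coord i (lam s)) @ within [set` `[c, d]] (nbhs t)
      --> cov_coord i (lam t).
    have h : (snd : 'rV[R]_n * 'cV[R]_n -> _) @ can_coord i (lam t)
      --> cov_coord i (lam t) by exact: cvg_snd.
    exact: (cvg_comp _ _ (lamc t tcd) h).
  case: k => j; rewrite /f.
    have Fc := cvg_comp _ _ xc (sX i 0%N _ ximg).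
    exact: (cvg_comp _ _ Fc (@coord_continuous _ _ _ 0 j _)).
  apply: cvgN; apply: cvg_pairing => //.
  exact: (cvg_comp _ _ xc ((sX i 1%N).2 (delta_mx 0 j) _ ximg)).
by exists K => k t tcd; rewrite fE// hK.
Qed.

(** With weights bounded by 1, the derivative of each canonical coordinate is at
    most the sum of the bounds for the two Hamiltonian fields on a compact
    interval. *)
Lemma bounded_control_ac_ccurve (X1 X2 : vfield M) (a b : R)
    (lam : R -> cotangent M) (w1 w2 : R -> R) :
  smooth_vfield X1 -> smooth_vfield X2 ->
  {within `[a, b], continuous (@basept R n M \o lam)} ->
  (forall t, t \in `[a, b] -> `|w1 t| <= 1 /\ `|w2 t| <= 1) ->
  (forall t, t \in `[a, b] -> cvelocity [set` `[a, b]] lam t (fun i =>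
    w1 t *: ham_field (ham_lift X1) (lam t) i
    + w2 t *: ham_field (ham_lift X2) (lam t) i)) ->
  ac_ccurve a b lam.
Proof.
move=> s1 s2 lamc w_le1 vel; split=> // i c d ac db dom.
have sub : [set` `[c, d]] `<=` [set` `[a, b]].
  move=> t /=; rewrite !in_itv/= => /andP[ct td].
  by rewrite (le_trans ac)// (le_trans td).
have dlam t : t \in `[c, d] ->
    deriv_within [set` `[c, d]] (can_coord i \o lam) t
    (w1 t *: ham_field (ham_lift X1) (lam t) i
    + w2 t *: ham_field (ham_lift X2) (lam t) i).
  move=> tcd; apply: (deriv_within_subset sub).
  by apply: vel; [exact: sub|exact: dom].
have cc t : t \in `[c, d] ->
    (can_coord i \o lam) @ within [set` `[c, d]] (nbhs t)
      --> can_coord i (lam t).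
  by move=> tcd; exact: deriv_within_continuous (dlam t tcd).
have [K1 hK1] := ham_field_bounded s1 dom cc.
have [K2 hK2] := ham_field_bounded s2 dom cc.
apply: (@lipschitz_abs_continuous _ _ _ _ (Num.max 0 (K1 + K2))).
move=> l r cl lr rd.
apply: norm_le_canon_coord => [|k].
  by rewrite mulr_ge0 ?subr_ge0// le_max lexx.
rewrite linearB.
apply: (@deriv_within_lipschitz _ c d _
  (canon_coord k \o (can_coord i \o lam))) => // t tcd.
  apply: deriv_within_comp; last exact: dlam.
  exact: continuous_canon_coord.
have [w1t w2t] := w_le1 t (sub _ tcd).
rewrite linearD !linearZ le_max; apply/orP; right.
rewrite (le_trans (ler_normD _ _))// lerD// normrM.
  by rewrite (le_trans _ (hK1 k t tcd))// ler_piMl.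
by rewrite (le_trans _ (hK2 k t tcd))// ler_piMl.
Qed.

(** Near q the transition from the preferred chart to itself is the identity,
    and the image of a chart is open, so its Jacobian is the identity matrix. *)
Lemma vec_coord_chart_at (q : M) (v : 'rV[R]_n) :
  vec_coord (chart_at q) q v = v.
Proof.
rewrite /vec_coord; set i := chart_at q.
have qi : chart_dom i q := chart_atP q.
have df : differentiable (transition i i) (chart i q).
  by apply: (transition_smooth i i 1%N).1; exists q.
rewrite -deriveEjacobian// -[RHS](derive_id (chart i q) v).
apply: near_eq_derive.
have : \forall x \near chart i q, (chart i @` chart_dom i) x.
  by apply: open_nbhs_nbhs; split; [exact: chart_img_open|exists q].
by apply: filterS => _ [y yi <-]; rewrite /transition /= chartK.
Qed.

Lemma frame_free (S : sub_riemannian2 M) (X1 X2 : vfield M) (q : M)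
    (a1 a2 b1 b2 : R) : orthonormal_frame S X1 X2 ->
  a1 *: X1 q + a2 *: X2 q = b1 *: X1 q + b2 *: X2 q -> a1 = b1 /\ a2 = b2.
Proof.
move=> [[_ D1] [_ D2] /(_ q)[g11 g22 g12]] ab.
have {D1 D2} [D1 D2] : X1 q \in Delta S q /\ X2 q \in Delta S q by split.
have g0 w : w \in Delta S q -> metric S q 0 w = 0.
  move=> wD; have := @metric_lin _ _ _ S q 1 0 0 w (mem0v _) (mem0v _) wD.
  by rewrite scaler0 addr0 mul1r => /esym/eqP; rewrite -subr_eq0 addrK => /eqP.
have gE (c1 c2 : R) w : w \in Delta S q ->
    metric S q (c1 *: X1 q + c2 *: X2 q) w =
    c1 * metric S q (X1 q) w + c2 * metric S q (X2 q) w.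
  move=> wD; rewrite metric_lin ?memvZ//.
  by rewrite -[c2 *: X2 q]addr0 metric_lin ?mem0v// g0// addr0.
have g21 : metric S q (X2 q) (X1 q) = 0 by rewrite Defs.metric_sym.
split.
  have := congr1 (fun v => metric S q v (X1 q)) ab.
  by rewrite /= !gE// g11 g21 !mulr0 !mulr1 !addr0.
have := congr1 (fun v => metric S q v (X2 q)) ab.
by rewrite /= !gE// g22 g12 !mulr0 !mulr1 !add0r.
Qed.
End Chart.

(** * Lifts of regular abnormal geodesics *)

(** In the definition of G the denominator dominates both numerators; the
    bound includes the degenerate quotient 0 / 0 = 0. *)
Lemma normr_div_sqrt_le1 (R : realType) (x y : R) :
  `|x / Num.sqrt (x ^+ 2 + y ^+ 2)| <= 1.
Proof.
have xs : `|x| <= Num.sqrt (x ^+ 2 + y ^+ 2).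
  by rewrite -sqrtr_sqr ler_wsqrtr// lerDl sqr_ge0.
rewrite normrM normfV (ger0_norm (sqrtr_ge0 _)).
have [->|s0] := eqVneq (Num.sqrt (x ^+ 2 + y ^+ 2)) 0.
  by rewrite invr0 mulr0.
by rewrite ler_pdivrMr ?mul1r// lt_neqAle eq_sym s0 sqrtr_ge0.
Qed.

(** The lift is the integral curve of G or -G itself, driven by the control that
    the geodesic has by definition. *)
Lemma abnormal_lift_of_regular_abnormal_geodesic (R : realType) (n : nat)
    (M : manifold R n) (S : sub_riemannian2 M) (X1 X2 : vfield M) (T : R)
    (gamma : R -> M) :
  orthonormal_frame S X1 X2 -> 0 < T ->
  regular_abnormal_geodesic X1 X2 T gamma ->
  exists lam, abnormal_lift X1 X2 T gamma lam.
Proof.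
move=> hX T0 [[lam [reg Glam lift]] [[v1 [v2 [ctrl _]]] _]].
have [[s1 _] [s2 _] _] := hX.
(* A sign treats the fields G and -G together. *)
have [sgn [sgn1 [lamc vlam]]] : exists sgn : R, `|sgn| = 1 /\
    {within `[0, T], continuous (@basept R n M \o lam)} /\
    forall t, t \in `[0, T] -> cvelocity [set` `[0, T]] lam t
      (fun i => sgn *: G_field X1 X2 (lam t) i).
  case: Glam => -[lamc vlam]; [exists 1|exists (-1)].
    split; first by rewrite normr1.
    by split=> // t tT i it; rewrite scale1r; exact: vlam.
  split; first by rewrite normrN1.
  by split=> // t tT i it; rewrite scaleN1r; exact: vlam.
pose r t := Num.sqrt (h212 X1 X2 (lam t) ^+ 2 + h112 X1 X2 (lam t) ^+ 2).
pose w1 t := sgn * (- h212 X1 X2 (lam t) / r t).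
pose w2 t := sgn * (h112 X1 X2 (lam t) / r t).
have {}vlam t : t \in `[0, T] -> cvelocity [set` `[0, T]] lam t (fun i =>
    w1 t *: ham_field (ham_lift X1) (lam t) i
    + w2 t *: ham_field (ham_lift X2) (lam t) i).
  move=> tT i it; have := vlam t tT i it.
  by rewrite /G_field scalerDr !scalerA.
have w_le1 t : t \in `[0, T] -> `|w1 t| <= 1 /\ `|w2 t| <= 1.
  move=> _; rewrite /w1 /w2 /r.
  move: (h212 X1 X2 (lam t)) (h112 X1 X2 (lam t)) => x y.
  have nsgn (z : R) : `|sgn * z| = `|z| by rewrite normrM sgn1 mul1r.
  rewrite !nsgn mulNr normrN; split; last rewrite addrC.
    exact: normr_div_sqrt_le1.
  exact: normr_div_sqrt_le1.
exists lam, v1, v2; split=> //.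
- exact: bounded_control_ac_ccurve lamc w_le1 vlam.
- move=> t tT; have [[h1t h2t h12t] nD3] := reg t tT; split=> //.
  apply/eqP => p0; apply: nD3.
  have h0 X : ham_lift X (lam t) = 0 by rewrite /ham_lift p0 mulmx0 mxE.
  split; [exact: h1t|exact: h2t|exact: h12t|exact: h0|exact: h0].
have [_ _ _ _] := ctrl.
apply: filterS; first exact: (ae_filter_ringOfSetsType lebesgue_measure).
move=> t velv tT.
have lt := lift t tT.
have [<- <-] : w1 t = v1 t /\ w2 t = v2 t; last exact: vlam.
apply: (frame_free hX (q := gamma t)).
pose i := chart_at (gamma t).
have it : chart_dom i (gamma t) := chart_atP _.
have lit : chart_dom i (basept (lam t)) by rewrite lt.
(* Both combinations of X1 and X2 are the velocity of gamma at t, read in the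
   preferred chart of gamma t: one by the choice of the control, the other as
   the x-component of the velocity of lam. *)
rewrite -[LHS](vec_coord_chart_at (gamma t)).
rewrite -[RHS](vec_coord_chart_at (gamma t)) -/i.
have dv := velv tT i it; apply: (deriv_within_unique T0 tT _ dv).
have fstc : continuous (fst : 'rV[R]_n * 'cV[R]_n -> 'rV[R]_n).
  by move=> w; exact: cvg_fst.
have dx : deriv_within [set` `[0, T]] (fst \o (can_coord i \o lam)) t
    (w1 t *: ham_field (ham_lift X1) (lam t) i
     + w2 t *: ham_field (ham_lift X2) (lam t) i).1.
  exact: (@deriv_within_comp _ _ _ _ fst _ _ _ (fstc _) (vlam t tT i lit)).
move: dx.
have fst_comb (a1 a2 : R) (u1 u2 : 'rV[R]_n * 'cV[R]_n) :
  (a1 *: u1 + a2 *: u2).1 = a1 *: u1.1 + a2 *: u2.1 by [].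
rewrite fst_comb (fst_ham_field_lift s1 lit) (fst_ham_field_lift s2 lit) lt.
rewrite /vec_coord !scalemxAl -mulmxDl.
by apply: deriv_within_eq => // s sT; rewrite /= lift.
Qed.

Lemma normal_lift_restrict (R : realType) (n : nat) (M : manifold R n)
    (X1 X2 : vfield M) (T tau : R) (gamma gbar : R -> M)
    (lam : R -> cotangent M) :
  tau <= T -> (forall t, t \in `[0, tau] -> gbar t = gamma t) ->
  normal_lift X1 X2 T gbar lam -> normal_lift X1 X2 tau gamma lam.
Proof.
move=> tauT eqg [lift [lamc vlam]].
have sub : [set` `[0, tau]] `<=` [set` `[0, T]].
  by move=> t /=; rewrite !in_itv/= => /andP[-> /le_trans]; exact.
split=> [t tt|]; first by rewrite lift ?eqg//; exact: sub.
split; first exact: continuous_subspaceW sub lamc.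
move=> t tt i it; apply: (deriv_within_subset sub).
by apply: vlam => //; exact: sub.
Qed.

Theorem proposition3p16 (R : realType) (n : nat) (M : manifold R n)
    (S : sub_riemannian2 M) (X1 X2 : vfield M)
    (hX : orthonormal_frame S X1 X2)
    (T tau : R) (gamma : R -> M)
    (hgamma : regular_abnormal_geodesic X1 X2 T gamma)
    (htau : 0 < tau < T)
    (hbranch : has_regular_abnormal_branching X1 X2 T gamma tau)
    (hstrict : strictly_abnormal X1 X2 tau gamma) :
  strictly_abnormal_geodesic X1 X2 T gamma /\
  forall (eps0 : R) (gbar : R -> M),
    branches_from X1 X2 T gamma tau eps0 gbar ->
    strictly_abnormal_geodesic X1 X2 (tau + eps0) gbar.
Proof.
have /andP[tau0 tauT] := htau; have [_ nonormal] := hstrict.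
have strict (T' : R) (g : R -> M) : tau <= T' ->
    regular_abnormal_geodesic X1 X2 T' g ->
    (forall t, t \in `[0, tau] -> g t = gamma t) ->
    strictly_abnormal_geodesic X1 X2 T' g.
  move=> tauT' hg eqg; split; first exact: hg.2.
  have T'0 : 0 < T' := lt_le_trans tau0 tauT'.
  split; first exact: abnormal_lift_of_regular_abnormal_geodesic hX T'0 hg.
  case=> lam nlam; apply: nonormal; exists lam.
  exact: normal_lift_restrict eqg nlam.
split; first by apply: strict; first exact: ltW.
move=> eps0 gbar [eps_gt0 hgbar eqg _].
by apply: strict => //; rewrite lerDl ltW.
Qed.
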